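(* Let $p$ be a prime. (1) $\rho_p(2,2)=\frac{7}{12}$ if $p=2$, and $\rho_p(2,2)=1-\frac{3}{2}p^{-1}\left(\frac{1-p^{-1}}{1-p^{-2}}\right)^2$ if $p\neq 2$. (2) $\rho_p(3,2)=\frac{1231}{1296}$ if $p=2$, and $\rho_p(3,2)=1-\frac{3}{2}p^{-2}\left(\frac{1-p^{-1}}{1-p^{-2}}\right)^4$ if $p\ne 2$. (3) If $n\ge 4$, then $\rho_p(n,2)=1$.
   Context: For $n,k\in\mathbb{Z}_{\ge 2}$ and $\mathbf a=(a_0,\dots,a_n)$, let $X^k_{\mathbf a}\subset\mathbb{P}^n$ denote the diagonal hypersurface $\sum_{i=0}^n a_ix_i^k=0$. For a prime $p$ let $\mu_p$ be the Haar measure on $\mathbb{Z}_p$ normalized by $\mu_p(\mathbb{Z}_p)=1$, and also the product measure on $\mathbb{Z}_p^{n+1}$. Define $\rho_p(n,k)=\mu_p(\{\mathbf a\in\mathbb{Z}_p^{n+1}: X^k_{\mathbf a}(\mathbb{Q}_p)\neq\emptyset\})$. *)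

(* Defs.v *)
From HB Require Import structures.
From mathcomp Require Import all_boot all_order all_algebra.
From mathcomp Require Import all_classical all_reals all_analysis.
Set Implicit Arguments. Unset Strict Implicit. Unset Printing Implicit Defensive.
Import Order.TTheory GRing.Theory Num.Theory.
Local Open Scope classical_set_scope.
Local Open Scope ring_scope.

(* The p-adic integers Z_p as the inverse limit of Z/p^m Z: a coherent
   sequence of residues x_m in [0, p^m) with x_{m+1} = x_m (mod p^m). *)
Definition zp (p : nat) :=
  {x : nat -> nat | forall m, (x m < p ^ m)%N /\ (x m.+1 %% p ^ m)%N = x m}.

Definition zval (p : nat) (x : zp p) (m : nat) : nat := proj1_sig x m.

Definition zvec (p n : nat) := 'I_n.+1 -> zp p.

(* sum_i a_i x_i^k = 0 in Z_p  (ring operations of Z_p are computed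
   componentwise modulo p^m in the inverse limit). *)
Definition diag_eq0 (p n k : nat) (a x : zvec p n) : Prop :=
  forall m, ((\sum_(i < n.+1) zval (a i) m * zval (x i) m ^ k) %% p ^ m)%N = 0%N.

(* X^k_a(Q_p) is nonempty: there is a nonzero vector with
   sum a_i x_i^k = 0 (coordinates scaled into Z_p). *)
Definition has_Qp_point (p n k : nat) (a : zvec p n) : Prop :=
  exists x : zvec p n, (exists i m, zval (x i) m <> 0%N) /\ diag_eq0 k a x.

Definition cyl (p n : nat) (c : 'I_n.+1 -> nat) (m : nat) : set (zvec p n) :=
  [set a | forall i, zval (a i) m = c i].

(* Normalized Haar (outer) measure on Z_p^{n+1}: Caratheodory outer measure
   generated by cylinders, the cylinder of level m having mass p^{-m(n+1)}. *)
Definition haar (R : realType) (p n : nat) (S : set (zvec p n)) : \bar R :=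
  ereal_inf [set (\sum_(0 <= j <oo) (((p%:R : R) ^- (cm.2 j * n.+1))%:E))%E
            | cm in [set cm : (nat -> ('I_n.+1 -> nat)) * (nat -> nat)
                      | S `<=` \bigcup_j cyl (cm.1 j) (cm.2 j)]].

Definition rho (R : realType) (p n k : nat) : \bar R :=
  haar R [set a : zvec p n | has_Qp_point k a].

(* Main.v *)
Require Import Defs.
From HB Require Import structures.
From mathcomp Require Import all_boot all_order all_algebra.
From mathcomp Require Import all_classical all_reals all_analysis.
From mathcomp Require Import zify ring.
Import Order.TTheory GRing.Theory Num.Theory.
Import numFieldNormedType.Exports.
Set Implicit Arguments. Unset Strict Implicit. Unset Printing Implicit Defensive.

(** Whether [sum_i a_i x_i^2] is isotropic over [Q_p] depends only on the types
    of the coefficients: the parity of the valuation and the class of the unit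
    part, namely its residue mod [8] if [p = 2] and its quadratic character if
    [p] is odd.  Indeed, dividing a zero by its terms of least valuation leaves a
    congruence mod [p^e] ([e = 3] for [p = 2], [e = 1] otherwise) with a unit
    among the variables of one parity, and conversely Hensel's lemma lifts such a
    congruence.  Up to a null set (some valuation [>= 2K], [K] large) the solvable
    set is thus a finite union of cylinders, and by compactness its outer measure
    is the corresponding count of residue vectors.  The types of the [a_i] are
    independent, a type of odd valuation having [1/p] times the weight of one of
    even valuation, so that [rho] is a polynomial in [1/p] whose coefficients
    count the isotropic tuples of types, divided by a power of the total weight. *)

(** * p-adic integers *)

Section Zp.
Variable p : nat.
Hypothesis p_gt0 : (0 < p)%N.

Lemma zval_lt (x : zp p) m : (zval x m < p ^ m)%N.
Proof. by case: x => f /= /(_ m) []. Qed.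

Lemma zval_mod (x : zp p) m k : (m <= k)%N -> (zval x k %% p ^ m)%N = zval x m.
Proof.
move=> /subnKC <-; elim: (k - m)%N => [|j IH]; first by rewrite addn0 modn_small ?zval_lt.
rewrite -{}IH addnS; have [_ E] := proj2_sig x (m + j)%N.
by rewrite /zval -E modn_dvdm // dvdn_exp2l // leq_addr.
Qed.

Lemma zp_of_seq (f : nat -> nat) :
  (forall m, f m.+1 = f m %[mod p ^ m]) ->
  exists x : zp p, forall m, zval x m = (f m %% p ^ m)%N.
Proof.
move=> fP.
have cP m : ((f m %% p ^ m < p ^ m)%N /\ ((f m.+1 %% p ^ m.+1) %% p ^ m)%N = (f m %% p ^ m)%N).
  by rewrite ltn_mod expn_gt0 p_gt0 modn_dvdm ?fP // dvdn_exp2l.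
by exists (exist _ (fun m => f m %% p ^ m)%N cP).
Qed.

Lemma zp_of_nat (c : nat) : exists x : zp p, forall m, zval x m = (c %% p ^ m)%N.
Proof. exact: (zp_of_seq (f := fun=> c)). Qed.

(** Dependent choice along the tree of residues, used for compactness and for Hensel's lemma. The
    representatives [c] need not be reduced, hence a congruence between successive levels rather
    than an equality. *)
Lemma zvec_of_path n (G : nat -> ('I_n.+1 -> nat) -> Prop) c0 :
  G 0%N c0 ->
  (forall m c, G m c -> exists c', (forall i, c' i = c i %[mod p ^ m]) /\ G m.+1 c') ->
  exists (a : zvec p n) (f : nat -> 'I_n.+1 -> nat),
    forall m, G m (f m) /\ forall i, zval (a i) m = (f m i %% p ^ m)%N.
Proof.
move=> G0 GS.
have [|next nextP] := @boolp.choice _ _ (fun mc c' => G mc.1 mc.2 ->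
    (forall i, c' i = mc.2 i %[mod p ^ mc.1]) /\ G mc.1.+1 c').
  move=> [m c]; have [/GS [c' ?]|nG] := pselect (G m c); first by exists c'.
  by exists c.
pose f := nat_rect (fun=> 'I_n.+1 -> nat) c0 (fun m c => next (m, c)).
have fG m : G m (f m) by elim: m => //= m /(nextP (m, f m)) [].
have fP i m : f m.+1 i = f m i %[mod p ^ m] by have [+ _] := nextP (m, f m) (fG m); apply.
have [a aP] := @boolp.choice _ _ (fun i (x : zp p) => forall m, zval x m = (f m i %% p ^ m)%N)
  (fun i => zp_of_seq (fP i)).
by exists a, f.
Qed.

End Zp.

(** * Cylinders and Haar measure *)

Lemma sum_modn a b (F : nat -> nat) : (0 < a)%N ->
  (\sum_(0 <= x < b * a) F (x %% a) = b * \sum_(0 <= x < a) F x)%N.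
Proof.
move=> a_gt0; rewrite big_nat_mul -[b in RHS]subn0 -sum_nat_const_nat.
apply: eq_bigr => i _; rewrite mulSn -{1}[(i * a)%N]add0n big_addn addnK.
by rewrite big_nat_cond [RHS]big_nat_cond; apply: eq_bigr => j /andP[/andP[_ ja] _]; rewrite addnC modnMDl modn_small.
Qed.

Lemma card_ord_sum N (P : pred nat) : #|[pred x : 'I_N | P x]| = (\sum_(0 <= x < N) P x)%N.
Proof. by rewrite -sum1_card big_mkcond big_mkord; apply: eq_bigr => i _; rewrite inE; case: (P i). Qed.

Section Haar.
Variable p : nat.
Hypothesis p_gt1 : (1 < p)%N.
Let p_gt0 : (0 < p)%N := ltnW p_gt1.
Let pX_gt0 m : (0 < p ^ m)%N. Proof. by rewrite expn_gt0 p_gt0. Qed.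

(** A residue mod [p ^ m] has [p ^ (L - m)] lifts, but a [c] out of range has none; centres of
    cylinders are arbitrary naturals, so both cases occur. *)
Lemma card_ord_mod m L c : (m <= L)%N ->
  (#|[pred x : 'I_(p ^ L) | x %% p ^ m == c]| <= p ^ (L - m) ?= iff (c < p ^ m))%N.
Proof.
move=> mL; rewrite (card_ord_sum (p ^ L) (fun x => x %% p ^ m == c)%N).
have E : (p ^ L = p ^ (L - m) * p ^ m)%N by rewrite -expnD subnK.
rewrite {1}E (sum_modn _ (fun x => x == c)) //.
suff -> : (\sum_(0 <= x < p ^ m) (x == c) = (c < p ^ m))%N.
  case: (c < _)%N; rewrite ?muln1 ?muln0; split => //.
    by rewrite eqxx.
  by rewrite ltn_eqF.
rewrite -(card_ord_sum (p ^ m) (fun x => x == c)) /=; case: ltnP => cm.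
  by rewrite /= -(card1 (Ordinal cm)); apply: eq_card => x; rewrite !inE.
by apply: eq_card0 => x; rewrite !inE; apply/negbTE; rewrite neq_ltn (leq_trans _ cm).
Qed.

Lemma card_ffun_mod n m L (c : 'I_n.+1 -> nat) : (m <= L)%N ->
  (#|[pred d : {ffun 'I_n.+1 -> 'I_(p ^ L)} | [forall i, d i %% p ^ m == c i]]|
   = \prod_i #|[pred x : 'I_(p ^ L) | x %% p ^ m == c i]|)%N.
Proof.
move=> mL.
transitivity #|family (fun i => [pred x : 'I_(p ^ L) | x %% p ^ m == c i])%N|.
  by apply: eq_card => d; rewrite inE.
by rewrite card_family foldrE big_map big_enum.
Qed.

Lemma card_ffun_mod_le n m L (c : 'I_n.+1 -> nat) : (m <= L)%N ->
  (#|[pred d : {ffun 'I_n.+1 -> 'I_(p ^ L)} | [forall i, d i %% p ^ m == c i]]|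
   <= p ^ ((L - m) * n.+1))%N.
Proof.
move=> mL; rewrite card_ffun_mod // expnM -[n.+1 in leqRHS]card_ord -prod_nat_const.
by apply: leq_prod => i _; case: (card_ord_mod (c i) mL).
Qed.

Lemma card_ffun_mod_eq n m L (c : 'I_n.+1 -> 'I_(p ^ m)) : (m <= L)%N ->
  (#|[pred d : {ffun 'I_n.+1 -> 'I_(p ^ L)} | [forall i, d i %% p ^ m == c i]]|
   = p ^ ((L - m) * n.+1))%N.
Proof.
move=> mL; rewrite (card_ffun_mod (fun i => c i : nat)) // expnM -[n.+1 in RHS]card_ord -prod_nat_const.
by apply: eq_bigr => i _; apply/eqP; case: (card_ord_mod (c i) mL) => _ ->.
Qed.

Definition zred n N (a : zvec p n) : {ffun 'I_n.+1 -> 'I_(p ^ N)} :=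
  [ffun i => Ordinal (zval_lt (a i) N)].

(** König's lemma: without a finite subcover, a nested sequence of residue classes keeps, for every
    [J], a point avoiding the first [J] cylinders. Its limit lies in some cylinder [j], against the
    points that avoid the first [j.+1]. *)
Lemma cyl_compact n N (C : pred {ffun 'I_n.+1 -> 'I_(p ^ N)})
    (c : nat -> 'I_n.+1 -> nat) (l : nat -> nat) :
  (forall a : zvec p n, C (zred N a) -> exists j, cyl (c j) (l j) a) ->
  exists J, forall a : zvec p n, C (zred N a) -> exists2 j, (j < J)%N & cyl (c j) (l j) a.
Proof.
move=> cov; apply: contrapT => /forallNP ncov.
pose free J (a : zvec p n) := C (zred N a) /\ forall j, (j < J)%N -> ~ cyl (c j) (l j) a.
pose G m (d : 'I_n.+1 -> nat) :=
  forall J, exists2 a, free J a & forall i, (d i %% p ^ m)%N = zval (a i) m.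
have freeW J J' a : (J <= J')%N -> free J' a -> free J a.
  by move=> JJ' [Ca fa]; split=> // j /leq_trans/(_ JJ')/fa.
have [||a [f fP]] := @zvec_of_path p p_gt0 n G (fun=> 0%N).
- move=> J; have /existsNP [a /not_implyP[Ca na]] := ncov J.
  exists a; first by split=> // j jJ ca; apply: na; exists j.
  by move=> i; have := zval_lt (a i) 0; rewrite modn1; case: (zval _ _).
- move=> m d Gd; apply: contrapT => /forallNP nG.
  (* If each of the finitely many refinements [e] of [d] fails at some [J e], none survives at the
     maximum of these bounds. *)
  have [J JP] := @boolp.choice _ _ (fun (e : {ffun 'I_n.+1 -> 'I_(p ^ m.+1)}) J =>
      (forall i, e i = d i %[mod p ^ m]) ->
      ~ exists2 a, free J a & forall i, (e i %% p ^ m.+1)%N = zval (a i) m.+1)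
    (fun e => ltac:(
      have [ed|ned] := pselect (forall i, e i = d i %[mod p ^ m]); [|by exists 0%N];
      have /not_andP[//|/existsNP[J ?]] := nG (fun i => e i); by exists J)).
  have [a fa da] := Gd (\max_e J e)%N.
  apply: (JP (zred m.+1 a)) => [i|]; first by rewrite ffunE /= zval_mod // da.
  exists a; last by move=> i; rewrite ffunE /= modn_small ?zval_lt.
  by apply: freeW fa; apply: leq_bigmax.
have Ca : C (zred N a).
  have [/(_ 0%N) [b [Cb _] fb] fa] := fP N.
  suff -> : zred N a = zred N b by [].
  by apply/ffunP => i; apply: val_inj; rewrite !ffunE /= fa fb.
have [j cj] := cov _ Ca.
have [/(_ j.+1) [b [_ /(_ j (ltnSn j)) nb] fb] fa] := fP (l j).
by apply: nb => i; rewrite -fb -fa; apply: cj.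
Qed.

Variable R : realType.
Local Open Scope ring_scope.
Let q_gt0 : 0 < (p%:R : R). Proof. by rewrite ltr0n. Qed.

(** By compactness finitely many members of a cover suffice, and at a common level [L] masses become
    numbers of residue vectors. *)
Lemma haar_ge n N (S : set (zvec p n)) (C : pred {ffun 'I_n.+1 -> 'I_(p ^ N)}) :
  (forall a, C (zred N a) -> S a) ->
  ((#|C|%:R / p%:R ^+ (N * n.+1))%:E <= haar R S)%E.
Proof.
move=> CS; apply: le_ereal_inf_tmp => _ [[c l] /= cov <-].
have [J JP] := @cyl_compact n N C c l (fun a Ca =>
  let: ex_intro2 j _ cj := cov a (CS a Ca) in ex_intro _ j cj).
apply: le_trans (nneseries_lim_ge J _); last first.
  by move=> j _ _; rewrite lee_fin invr_ge0 exprn_ge0 // ltW.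
rewrite sumEFin lee_fin big_mkord.
pose L := maxn N (\max_(j < J) l j).
have NL : (N <= L)%N by rewrite leq_maxl.
have lL (j : 'I_J) : (l j <= L)%N.
  by apply: leq_trans (leq_maxr _ _); apply: (@leq_bigmax _ (fun j : 'I_J => l j)).
have key : (#|C| * p ^ ((L - N) * n.+1) <= \sum_(j < J) p ^ ((L - l j) * n.+1))%N.
  pose red (d : {ffun 'I_n.+1 -> 'I_(p ^ L)}) : {ffun 'I_n.+1 -> 'I_(p ^ N)} :=
    [ffun i => Ordinal (ltn_pmod (d i) (pX_gt0 N))].
  have -> : (#|C| * p ^ ((L - N) * n.+1) = \sum_(d | C (red d)) 1)%N.
    rewrite (partition_big red C) // -sum_nat_const.
    apply: eq_bigr => e Ce; rewrite -(card_ffun_mod_eq e NL) -sum1_card.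
    apply: eq_bigl => d; rewrite !inE; apply/forallP/andP => [de|[_ /eqP <-] i]; last by rewrite ffunE.
    have -> : red d = e by apply/ffunP => i; apply: val_inj; rewrite ffunE /=; apply/eqP.
    by rewrite eqxx.
  rewrite big_mkcond.
  apply: (@leq_trans (\sum_(j < J) #|[pred d : {ffun 'I_n.+1 -> 'I_(p ^ L)} |
      [forall i, d i %% p ^ l j == c j i]]|)%N); last first.
    by apply: leq_sum => j _; apply: card_ffun_mod_le.
  under [leqRHS]eq_bigr do rewrite -sum1_card big_mkcond.
  rewrite exchange_big; apply: leq_sum => d _; case: ifP => // Cd.
  (* The integer vector [d] is itself a p-adic point, so it lies in one of the first [J]
     cylinders. *)
  have [a aP] := @boolp.choice _ _ (fun i (x : zp p) => forall m, zval x m = (d i %% p ^ m)%N)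
    (fun i => zp_of_nat p_gt0 (d i)).
  have [|j jJ cj] := JP a.
    by congr C: Cd; apply/ffunP => i; apply: val_inj; rewrite !ffunE /= aP.
  rewrite (bigD1 (Ordinal jJ)) //= inE ifT //.
  by apply/forallP => i; rewrite -aP (cj i).
have qL (k : nat) : (k <= L)%N -> (p%:R : R) ^- (k * n.+1) = (p ^ ((L - k) * n.+1))%:R / p%:R ^+ (L * n.+1).
  move=> kL; rewrite natrX -{2}(subnK kL) mulnDl exprD invfM mulrA divff ?mul1r //.
  by rewrite expf_neq0 // gt_eqF.
rewrite qL // (eq_bigr (fun j : 'I_J => (p ^ ((L - l j) * n.+1))%:R / p%:R ^+ (L * n.+1))); last first.
  by move=> j _; rewrite qL.
rewrite -mulr_suml mulrA ler_pM2r ?invr_gt0 ?exprn_gt0 // -natr_sum -natrM ler_nat.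
exact: key.
Qed.

Lemma haar_le n N (S : set (zvec p n)) (C : pred {ffun 'I_n.+1 -> 'I_(p ^ N)}) :
  (forall a, S a -> C (zred N a)) ->
  (haar R S <= (#|C|%:R / p%:R ^+ (N * n.+1))%:E)%E.
Proof.
move=> SC; apply/lee_addgt0Pr => e e_gt0.
have [M Me] : exists M : nat, 2 ^- M <= e.
  exists (Num.bound e^-1); rewrite -[leRHS]invrK lef_pV2 ?posrE ?invr_gt0 ?exprn_gt0 //.
  apply: le_trans (ltW (archi_boundP _)) _; first by rewrite invr_ge0 ltW.
  rewrite -natrX ler_nat.
  by apply: ltnW; apply: ltn_expl.
(* A cover is an infinite sequence: after the [k] useful cylinders of level [N] it is padded by
   cylinders of level [M + j.+1], of mass at most [e / 2 ^ j.+1]. *)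
pose k := size (enum C).
pose c j (i : 'I_n.+1) : nat := 
  if (j < k)%N then nat_of_ord (nth [ffun=> Ordinal (pX_gt0 N)] (enum C) j i) else 0%N.
pose l j := if (j < k)%N then N else (M + j.+1)%N.
have cov : (S `<=` \bigcup_j cyl (c j) (l j))%classic.
  move=> a /SC Ca; exists (index (zred N a) (enum C)) => // i.
  have mC : zred N a \in enum C by rewrite mem_enum.
  by rewrite /c /l index_mem mC nth_index // ffunE.
apply: le_trans (ereal_inf_lbound _) _.
  by exists (c, l); [exact: cov|reflexivity].
pose A j : \bar R := (if (j < k)%N then p%:R ^- (N * n.+1) else 0)%:E.
apply: (@le_trans _ _ (\sum_(0 <= j <oo) (A j + (e / (2 ^ j.+1)%:R)%:E))%E).
  apply: lee_nneseries => [j _ _|j _ /=].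
    by rewrite lee_fin invr_ge0 exprn_ge0 // ltW.
  rewrite /l /A; case: ifP => _; rewrite -EFinD lee_fin.
    by rewrite lerDl divr_ge0 // ltW.
  rewrite add0r; apply: (@le_trans _ _ (2 ^- (M + j.+1))).
    rewrite lef_pV2 ?posrE ?exprn_gt0 // -!natrX ler_nat.
    apply: leq_trans (_ : p ^ (M + j.+1) <= _)%N; first by rewrite leq_exp2r // addnS.
    by rewrite leq_exp2l // leq_pmulr.
  by rewrite exprD invfM natrX ler_pM2r ?invr_gt0 ?exprn_gt0.
apply: le_trans (epsilon_trick xpredT _ (ltW e_gt0)) _.
  by move=> j; rewrite /A; case: ifP => _; rewrite lee_fin // invr_ge0 exprn_ge0 // ltW.
apply: leeD2r; rewrite (@nneseries_split _ _ 0 k); last first.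
  by move=> j _; rewrite /A; case: ifP => _; rewrite lee_fin // invr_ge0 exprn_ge0 // ltW.
rewrite add0n [X in (_ + X)%E]eseries0 ?adde0; last first.
  by move=> j kj _; rewrite /A ltnNge kj.
rewrite sumEFin lee_fin big_mkord (eq_bigr (fun=> p%:R ^- (N * n.+1))); last by move=> j _; rewrite ltn_ord.
by rewrite sumr_const card_ord /k -cardE mulr_natl.
Qed.

End Haar.

(** * Hensel's lemma *)

(* A unit square mod [p ^ (2 v_p(2) + 1)] lifts to a square in [Z_p]. *)
Definition lift_exp (p : nat) : nat := (p == 2).*2.+1.

Definition vtype (p c : nat) : bool * nat := (odd (logn p c), c %/ p ^ logn p c).

(** A term of the form divided by a power of [p] of parity [s]: even powers of [p] are absorbed by
    [x], so at most one factor [p] remains. *)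
Definition sterm (p : nat) (s : bool) (t : bool * nat) (x : nat) : nat :=
  p ^ (t.1 != s) * t.2 * x ^ 2.

(* Each [t i] is the parity of a valuation together with a unit part; [s] is the
   parity of the least valuation among the terms of a zero. *)
Definition iso_fun p n (t : 'I_n.+1 -> bool * nat) :=
  exists s (x : 'I_n.+1 -> nat), (exists2 i, (t i).1 = s & ~~ (p %| x i)) /\
    p ^ lift_exp p %| \sum_i sterm p s (t i) (x i).

Section Arith.
Variable p : nat.
Hypothesis p_prime : prime p.
Let p_gt0 : 0 < p := prime_gt0 p_prime.
Let p_gt1 : 1 < p := prime_gt1 p_prime.
Let pX_gt0 m : 0 < p ^ m. Proof. by rewrite expn_gt0 p_gt0. Qed.

Lemma logn_unit v u : ~~ (p %| u) -> logn p (p ^ v * u) = v.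
Proof.
move=> pu; have u_gt0 : 0 < u by case: u pu; rewrite ?dvdn0.
by rewrite lognM // pfactorK // lognE p_prime u_gt0 (negbTE pu) addn0.
Qed.

Lemma unit_part c : 0 < c -> c = p ^ logn p c * (c %/ p ^ logn p c).
Proof. by move=> c_gt0; rewrite mulnC divnK // pfactor_dvdnn. Qed.

Lemma unit_partN c : 0 < c -> ~~ (p %| c %/ p ^ logn p c).
Proof.
move=> c_gt0; have := pfactor_dvdn (logn p c).+1 p_prime c_gt0.
rewrite ltnn => /negbT; apply: contra => /(dvdn_mul (dvdnn (p ^ logn p c))).
by rewrite -unit_part // expnSr.
Qed.

Lemma logn_lt c m : 0 < c -> c < p ^ m -> logn p c < m.
Proof.
move=> c0 cm; rewrite -(ltn_exp2l _ _ p_gt1); apply: leq_ltn_trans cm.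
by apply: dvdn_leq => //; apply: pfactor_dvdnn.
Qed.

(** With [v] the valuation of [c] and [U] its unit part, [c'] is [p ^ v] times [U] plus a multiple
    of [p ^ (m - v)], and [v < m]. *)
Lemma vtype_lift c c' m : 0 < c -> c = c' %% p ^ m ->
  [/\ 0 < c', logn p c' = logn p c
    & c' %/ p ^ logn p c = c %/ p ^ logn p c %[mod p ^ (m - logn p c)]].
Proof.
move=> c0 cE; set v := logn p c; set U := c %/ p ^ v.
have vm : v < m by apply: logn_lt => //; rewrite cE ltn_mod.
have c'E : c' = p ^ v * (c' %/ p ^ m * p ^ (m - v) + U).
  rewrite mulnDr -unit_part // {1}(divn_eq c' (p ^ m)) cE mulnCA -expnD subnKC //.
  exact: ltnW.
have pU : ~~ (p %| c' %/ p ^ m * p ^ (m - v) + U).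
  by rewrite dvdn_addr ?unit_partN // dvdn_mull // dvdn_exp // subn_gt0.
split.
- by case: (posnP c') c0 => // c'0; rewrite cE c'0 mod0n.
- by rewrite c'E logn_unit.
by rewrite {1}c'E mulKn // modnMDl.
Qed.

Lemma eq_modn_dvd d m1 m2 : m1 = m2 %[mod d] -> (d %| m1) = (d %| m2).
Proof. by move=> E; rewrite /dvdn E. Qed.

Lemma eq_modnD d m1 m2 n1 n2 :
  m1 = m2 %[mod d] -> n1 = n2 %[mod d] -> m1 + n1 = m2 + n2 %[mod d].
Proof. by move=> E1 E2; rewrite -modnDm E1 E2 modnDm. Qed.

Lemma eq_modnM d m1 m2 n1 n2 :
  m1 = m2 %[mod d] -> n1 = n2 %[mod d] -> m1 * n1 = m2 * n2 %[mod d].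
Proof. by move=> E1 E2; rewrite -modnMm E1 E2 modnMm. Qed.

Lemma eq_modnX d m1 m2 k : m1 = m2 %[mod d] -> m1 ^ k = m2 ^ k %[mod d].
Proof. by move=> E; rewrite -modnXm E modnXm. Qed.

Lemma eq_modn_sum d (I : finType) (P : pred I) (F G : I -> nat) :
  (forall i, P i -> F i = G i %[mod d]) -> \sum_(i | P i) F i = \sum_(i | P i) G i %[mod d].
Proof. by move=> E; elim/big_rec2: _ => // i x y /E; apply: eq_modnD. Qed.

Lemma eq_modn_dvdm d d' m1 m2 : d %| d' -> m1 = m2 %[mod d'] -> m1 = m2 %[mod d].
Proof. by move=> dd E; rewrite -(modn_dvdm m1 dd) E modn_dvdm. Qed.

Lemma modn_linear_solve w r : ~~ (p %| w) -> exists t, p %| r + w * t.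
Proof.
move=> pw; have cwp : coprime w p by rewrite coprime_sym prime_coprime.
have w0 : 0 < w by case: (w) pw; rewrite ?dvdn0.
(* Here [u] inverts [w] mod [p] and [p.-1] stands for [-1]. *)
have /(coprimeP _ w0) [[u v] /= uv] := cwp; exists (r * p.-1 * u).
have uE : u * w = v * p + 1 by lia.
have -> : r + w * (r * p.-1 * u) = r + r * p.-1 * (u * w) by ring.
rewrite uE mulnDr muln1 addnCA dvdn_addr; last by rewrite mulnA dvdn_mull.
by rewrite -mulnS prednK // dvdn_mull.
Qed.

(* The exponent loss at [p = 2] comes from the derivative [2 A y]. *)
Lemma hensel_step A B V M y : 0 < A -> logn p A = V -> ~~ (p %| y) ->
  V + lift_exp p <= M -> p ^ M %| A * y ^ 2 + B ->
  exists2 y', y' = y %[mod p ^ (M - V - (p == 2))] & p ^ M.+1 %| A * y' ^ 2 + B.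
Proof.
move=> A0 AV py VM /dvdnP [r rE]; set d : nat := p == 2; set k := M - V - d.
(* Writing [2 = p ^ d * u2] with [u2] a unit treats [p = 2] and odd [p] together. *)
have [u2 u2E pu2] : exists2 u, 2 = p ^ d * u & ~~ (p %| u).
  rewrite /d; case: eqP => [->|p2]; first by exists 1.
  by exists 2; rewrite // gtnNdvd // ltn_neqAle p_gt1 andbT; apply/eqP => E; apply: p2.
have [A' AE pA'] : exists2 A', A = p ^ V * A' & ~~ (p %| A').
  by exists (A %/ p ^ V); rewrite -AV ?unit_partN // -unit_part.
have pw : ~~ (p %| u2 * A' * y) by rewrite !Euclid_dvdM // !negb_or pu2 pA' py.
have [t /dvdnP [j jE]] := modn_linear_solve r pw.
(* Newton correction: as [M = V + d + k], the linear term is [p ^ M] times a unit times [t], and [t]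
   was chosen to cancel [r] mod [p]. The quadratic term has exponent at least [V + 2k], which
   exceeds [M] because [k > d]. *)
exists (y + p ^ k * t); first by rewrite addnC mulnC modnMDl.
have eE : lift_exp p = (d + d).+1 by rewrite /lift_exp addnn.
have kM : M = V + d + k by rewrite /k; move: VM; rewrite eE; lia.
have -> : A * (y + p ^ k * t) ^ 2 + B = p ^ M * (r + u2 * A' * y * t) + A' * p ^ (V + k + k) * t ^ 2.
  rewrite mulnDr [p ^ M * r]mulnC -rE sqrnD AE kM !expnD -!mulnn u2E.
  move: (p ^ V) (p ^ d) (p ^ k) => X Y Z; ring.
rewrite jE; apply: dvdn_add; first by rewrite expnS mulnCA dvdn_mull // mulnC.
apply: dvdn_mulr; apply: dvdn_mull; apply: dvdn_exp2l; move: VM; rewrite kM eE; lia.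
Qed.

(** Iteration of the step. The approximations run [V + e] levels ahead, which makes up for the
    [V + (p == 2)] digits that each step leaves undetermined. *)
Lemma hensel (A B : nat -> nat) V y :
  (forall m, A m.+1 = A m %[mod p ^ m]) -> (forall m, B m.+1 = B m %[mod p ^ m]) ->
  (forall m, V + lift_exp p <= m -> 0 < A m /\ logn p (A m) = V) -> ~~ (p %| y) ->
  p ^ (V + lift_exp p) %| A (V + lift_exp p) * y ^ 2 + B (V + lift_exp p) ->
  exists x : zp p, ~~ (p %| zval x 1) /\ forall m, p ^ m %| A m * zval x m ^ 2 + B m.
Proof.
move=> cA cB AV py Hy; set e := lift_exp p in Hy *.
pose L m := m + (V + e).
have cF F m : (forall m, F m.+1 = F m %[mod p ^ m]) -> F (L m) = F m %[mod p ^ m].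
  move=> cF; rewrite /L; elim: (V + e) => [|j IH]; first by rewrite addn0.
  rewrite addnS -IH; apply: eq_modn_dvdm (cF _); exact: dvdn_exp2l (leq_addr _ _).
pose G m (c : 'I_1 -> nat) :=
  ~~ (p %| c ord0) /\ p ^ L m %| A (L m) * c ord0 ^ 2 + B (L m).
have [||a [f fP]] := @zvec_of_path p p_gt0 0 G (fun=> y); first by split.
- move=> m c [pc Hc].
  have VL : V + e <= L m.+1 by apply: leq_addl.
  have [A0 AL] := AV _ VL.
  have Hc' : p ^ L m %| A (L m.+1) * c ord0 ^ 2 + B (L m.+1).
    by rewrite (eq_modn_dvd (eq_modnD (eq_modnM (cA _) (erefl _)) (cB _))).
  have [|y' y'E Hy'] := hensel_step A0 AL pc _ Hc'; first by rewrite leq_addl.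
  have mk : m.+1 <= L m - V - (p == 2).
    by rewrite /L /e /lift_exp addnCA addKn; case: (p == 2) => /=; rewrite ?subn0 ?addn1 // subn1 !addnS /= addn0 leqnSn.
  exists (fun=> y'); split.
    move=> i; rewrite (ord1 i); apply: eq_modn_dvdm y'E.
    by apply: dvdn_exp2l; apply: ltnW.
  split=> //; rewrite (eq_modn_dvd (m2 := c ord0)) //.
  by apply: eq_modn_dvdm y'E; apply: dvdn_exp; rewrite ?(leq_trans _ mk).
exists (a ord0); split.
  have [[pf _] ->] := fP 1; rewrite expn1.
  by rewrite (eq_modn_dvd (m2 := f 1 ord0)) // modn_mod.
move=> m; have [[pf Hf] ->] := fP m.
rewrite (eq_modn_dvd (m2 := A (L m) * f m ord0 ^ 2 + B (L m))).
  by apply: dvdn_trans Hf; apply: dvdn_exp2l; apply: leq_addr.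
apply: eq_modnD; last by rewrite cF.
by apply: eq_modnM; [rewrite cF|apply: eq_modnX; rewrite modn_mod].
Qed.

End Arith.

(** * Solvability in terms of types *)

(** At level [K.*2 + e] such a residue determines its type. The even bound lets each parity of the
    valuation occur [K] times. *)
Definition small_val (p K c : nat) : bool := (0 < c) && (logn p c < K.*2).

Section Criterion.
Variables (p n K : nat).
Hypothesis p_prime : prime p.
Let p_gt0 : 0 < p := prime_gt0 p_prime.
Let p_gt1 : 1 < p := prime_gt1 p_prime.
Let pX_gt0 m : 0 < p ^ m. Proof. by rewrite expn_gt0 p_gt0. Qed.
Let e := lift_exp p.
Let N := K.*2 + e.

Lemma small_val_lift (x : zp p) m : small_val p K (zval x N) -> N <= m ->
  [/\ 0 < zval x m, logn p (zval x m) = logn p (zval x N)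
    & exists2 U, zval x m = p ^ logn p (zval x N) * U & U = (vtype p (zval x N)).2 %[mod p ^ e]].
Proof.
move=> /andP[x0 xK] Nm; have [m0 mv mU] := vtype_lift p_prime x0 (esym (zval_mod x Nm)).
split=> //; exists (zval x m %/ p ^ logn p (zval x N)).
  by rewrite -mv -unit_part.
apply: eq_modn_dvdm mU; apply: dvdn_exp2l.
by rewrite /N -addnBAC ?leq_addl // ltnW.
Qed.

Lemma sterm_mod s b U U' x : U = U' %[mod p ^ e] ->
  sterm p s (b, U) x = sterm p s (b, U') x %[mod p ^ e].
Proof. by move=> E; apply: eq_modnM => //; apply: eq_modnM. Qed.

(** Rescaling the variables by powers of [p] brings all terms to exponent [V] or [V + 1]. Hensel's
    lemma then moves the variable [i0] alone, the others staying fixed integers. *)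
Lemma iso_fun_point (a : zvec p n) : (forall i, small_val p K (zval (a i) N)) ->
  iso_fun p (fun i => vtype p (zval (a i) N)) -> has_Qp_point 2 a.
Proof.
move=> ga [s [x [[i0 i0s px] Hx]]].
pose v i := logn p (zval (a i) N); pose w i := (v i)./2.
have wK i : w i <= K by have /andP[_ /ltnW] := ga i; rewrite /w -/(v i) -leq_double; lia.
(* The exponent solves [v i + 2 * exponent = V + (odd (v i) != s)] for [V = K.*2 + s]; an even
   valuation with [s] odd needs one more factor [p]. *)
pose Y i := p ^ (K + (s && ~~ odd (v i)) - w i) * x i.
set V := K.*2 + s.
have NV : N <= V + e by rewrite /N /V; lia.
have key m : N <= m -> forall i, zval (a i) m * Y i ^ 2 =
    p ^ V * sterm p s (vtype p (zval (a i) N)) (x i) %[mod p ^ (V + e)].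
  move=> Nm i; have [_ _ [U -> UE]] := small_val_lift (ga i) Nm.
  rewrite [in RHS]/vtype -/(v i).
  have -> : p ^ v i * U * Y i ^ 2 = p ^ V * sterm p s (odd (v i), U) (x i).
    rewrite /Y /sterm expnMn -expnM mulnA [p ^ v i * U]mulnC -(mulnA U) -expnD.
    have -> : v i + (K + (s && ~~ odd (v i)) - w i) * 2 = V + (odd (v i) != s).
      rewrite mulnBl -[in LHS](odd_double_half (v i)) -/(w i) /V.
      have := wK i; case: (odd (v i)); case: (s) => /=; lia.
    by rewrite expnD; ring.
  by rewrite expnD -!muln_modr // (sterm_mod _ _ _ UE).
(* [A] absorbs the square of the scaling factor of [Y i0], so that the unknown is the unit [x i0]
   and [A] has valuation exactly [V]. *)
pose A m := zval (a i0) m * p ^ (K - w i0).*2.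
pose B m := \sum_(i | i != i0) zval (a i) m * Y i ^ 2.
have AY m (z : nat) : A m * z ^ 2 = zval (a i0) m * (p ^ (K - w i0) * z) ^ 2.
  by rewrite /A -mul2n mulnC expnMn -expnM [2 * _]mulnC; ring.
have Y0 : Y i0 = p ^ (K - w i0) * x i0.
  by move: i0s; rewrite /Y -/(v i0) /= => ->; rewrite andbN addn0.
have zM (z : zp p) m : zval z m.+1 = zval z m %[mod p ^ m].
  by rewrite zval_mod // modn_small // zval_lt.
have [|||||z [pz Hz]] := @hensel p p_prime A B V (x i0).
- by move=> m; apply: eq_modnM.
- by move=> m; apply: eq_modn_sum => i _; apply: eq_modnM.
- move=> m Vm; have [a0 av _] := small_val_lift (ga i0) (leq_trans NV Vm).
  split; first by rewrite muln_gt0 a0 pX_gt0.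
  rewrite lognM ?pX_gt0 // av pfactorK // -/(v i0) /V -i0s /= -/(v i0).
  by rewrite -[X in X + _](odd_double_half (v i0)) -/(w i0); have := wK i0; lia.
- exact: px.
- rewrite (_ : A _ * _ + _ = \sum_i zval (a i) (V + e) * Y i ^ 2); last first.
    by rewrite AY -Y0 [RHS](bigD1 i0).
  rewrite (eq_modn_dvd (eq_modn_sum (fun i _ => key _ NV i))).
  by rewrite -big_distrr expnD dvdn_pmul2l.
have cz m : p ^ (K - w i0) * zval z m.+1 = p ^ (K - w i0) * zval z m %[mod p ^ m].
  exact: eq_modnM.
have [X0 X0E] := zp_of_seq p_gt0 cz.
have [X1 X1E] := @boolp.choice _ _ (fun i (y : zp p) => forall m, zval y m = Y i %% p ^ m)
  (fun i => zp_of_nat p_gt0 (Y i)).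
exists (fun i => if i == i0 then X0 else X1 i); split.
  (* Since [z] is a unit, coordinate [i0] has valuation [K - w i0] and is nonzero one level
     further. *)
  exists i0, (K - w i0).+1; rewrite eqxx X0E => /eqP; apply/negP.
  rewrite -/(_ %| _) expnSr dvdn_pmul2l //; apply: contra pz.
  move=> /eqP z0; rewrite -(zval_mod z (isT : 1 <= (K - w i0).+1)) expn1 /dvdn z0.
  by rewrite mod0n.
move=> m; apply/eqP; rewrite -/(_ %| _) -(eq_modn_dvd (m1 := A m * zval z m ^ 2 + B m)) //.
rewrite [in RHS](bigD1 i0) //= eqxx AY; apply: eq_modnD.
  by apply: eq_modnM => //; apply: eq_modnX; rewrite X0E modn_mod.
apply: eq_modn_sum => i /negbTE ->; apply: eq_modnM => //; apply: eq_modnX.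
by rewrite X1E modn_mod.
Qed.

(** Divide by the least valuation [k i0] of a term. The excess [k i - k i0] is odd exactly when the
    parity of [v i] differs from [s]; its half, rounded down, is the power of [p] put into [z i].
    Variables vanishing mod [p ^ m] become 0. *)
Lemma point_iso_fun (a : zvec p n) : (forall i, small_val p K (zval (a i) N)) ->
  has_Qp_point 2 a -> iso_fun p (fun i => vtype p (zval (a i) N)).
Proof.
move=> ga [x [[i1 [m1 /eqP x1]] Hx]]; rewrite -lt0n in x1.
pose v i := logn p (zval (a i) N).
(* [m] is at least [k i1 + e], hence at least [k i0 + e], so a congruence mod [p ^ e] survives the
   division by [p ^ k i0]. *)
pose m := N + m1 + (v i1 + (logn p (zval (x i1) m1)).*2) + e.
have Nm : N <= m by rewrite /m; lia.
have m1m : m1 <= m by rewrite /m; lia.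
have [x1m x1l _] := vtype_lift p_prime x1 (esym (zval_mod (x i1) m1m)).
pose X i := zval (x i) m.
pose k i := v i + (logn p (X i)).*2.
have [i0 /= X0 kmin] := @arg_minnP _ i1 (fun i => 0 < X i) k x1m.
pose s := odd (v i0).
pose z i := if 0 < X i then p ^ (k i - k i0)./2 * (X i %/ p ^ logn p (X i)) else 0.
exists s, z; split.
  exists i0 => //; rewrite /z X0 subnn mul1n; exact: unit_partN.
have key i : zval (a i) m * X i ^ 2 =
    p ^ k i0 * sterm p s (vtype p (zval (a i) N)) (z i) %[mod p ^ (k i0 + e)].
  have [_ _ [U -> UE]] := small_val_lift (ga i) Nm.
  rewrite [in RHS]/vtype -/(v i).
  suff -> : p ^ v i * U * X i ^ 2 = p ^ k i0 * sterm p s (odd (v i), U) (z i).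
    by rewrite expnD -!muln_modr // (sterm_mod _ _ _ UE).
  rewrite /z; case: ifP => Xi; last first.
    by move/negbT: Xi; rewrite -eqn0Ngt => /eqP ->; rewrite /sterm exp0n // !muln0.
  have kk := kmin i Xi.
  rewrite [X i in LHS](unit_part p Xi).
  move: (X i %/ _) => y; rewrite /sterm /= !expnMn -!expnM.
  have -> : p ^ v i * U * (p ^ (logn p (X i) * 2) * y ^ 2) = p ^ k i * (U * y ^ 2).
    by rewrite /k -muln2 expnD; ring.
  have {1}-> : k i = k i0 + ((odd (v i) != s) + (k i - k i0)./2 * 2).
    have -> : odd (v i) != s = odd (k i - k i0).
      by rewrite oddB // /k !oddD !odd_double !addbF /s; case: (odd _); case: (odd _).
    by rewrite muln2 odd_double_half subnKC.
  by rewrite !expnD; ring.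
have km : k i0 + e <= m.
  rewrite /m leq_add2r; apply: leq_trans (leq_addl _ _); rewrite -x1l.
  exact: (kmin i1 x1m).
have : p ^ (k i0 + e) %| \sum_i zval (a i) m * X i ^ 2.
  by apply: dvdn_trans (dvdn_exp2l _ km) _; rewrite /dvdn Hx.
rewrite (eq_modn_dvd (eq_modn_sum (fun i _ => key i))).
by rewrite -big_distrr expnD dvdn_pmul2l.
Qed.

End Criterion.

(** * Density of the types *)

Lemma sum_nat_dvdn p M (F : nat -> nat) : 0 < p ->
  \sum_(0 <= c < M * p | p %| c) F c = \sum_(0 <= i < M) F (i * p).
Proof.
move=> p0; rewrite big_mkcond big_nat_mul; apply: eq_bigr => i _.
rewrite big_ltn ?ltn_pmul2r // dvdn_mull // big_nat_cond big1 /= ?addn0 //.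
move=> j /andP[/andP[ij ji] _]; case: ifP => // /dvdnP [k kE].
by move: ij ji; rewrite kE !ltn_pmul2r // ltnS => ik ki; rewrite ltnNge ki in ik.
Qed.

Section Counting.
Variables (p : nat) (C : finType) (kappa : nat -> C) (h : nat).
Hypothesis p_prime : prime p.
Let p_gt0 : 0 < p := prime_gt0 p_prime.
Let pX_gt0 m : 0 < p ^ m. Proof. by rewrite expn_gt0 p_gt0. Qed.
Let e := lift_exp p.
Hypothesis kappa_mod : forall u, kappa (u %% p ^ e) = kappa u.
Hypothesis kappa_card : forall k,
  \sum_(0 <= r < p ^ e) (~~ (p %| r) && (kappa r == k)) = h.

(** Types with a finite set [C] of unit classes: [kappa] will be [class8] for [p = 2] and [qres p]
    for odd [p], each class holding [h] unit residues mod [p ^ e]. *)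
Definition ctype (c : nat) : bool * C := (odd (logn p c), kappa (c %/ p ^ logn p c)).

Definition ctype_count K (t : bool * C) :=
  \sum_(0 <= c < p ^ (K + e)) ([&& 0 < c, logn p c < K & ctype c == t]).

Lemma ctype_count0 t : ctype_count 0 t = 0.
Proof. by apply: big1 => i _; rewrite ltn0 andbF. Qed.

(** Non-multiples of [p] have valuation 0 and meet each residue mod [p ^ e] equally often; dividing
    a multiple of [p] by [p] flips the parity and keeps the class. *)
Lemma ctype_countS K b k :
  ctype_count K.+1 (b, k) = ~~ b * (p ^ K.+1 * h) + ctype_count K (~~ b, k).
Proof.
rewrite /ctype_count addSn expnSr.
rewrite (bigID (fun c => p %| c)) /= addnC; congr (_ + _).
  rewrite big_mkcond.
  rewrite (eq_bigr (fun c => ~~ b * (~~ (p %| c) && (kappa c == k)))); last first.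
    move=> c _; case: ifPn => [pc|_]; last by rewrite muln0.
    have c0 : 0 < c by case: c pc; rewrite ?dvdn0.
    rewrite /ctype lognE p_prime c0 (negbTE pc) /= expn0 divn1 xpair_eqE.
    by case: b => //=; rewrite mul1n.
  rewrite -big_distrr /=; congr (_ * _).
  rewrite -expnSr -addSn expnD -(kappa_card k) -sum_modn //; apply: eq_bigr => c _.
  rewrite kappa_mod (@eq_modn_dvd p (c %% p ^ e) c) //.
  by rewrite modn_dvdm // dvdn_exp.
rewrite sum_nat_dvdn //; apply: eq_bigr => c _; rewrite muln_gt0 p_gt0 andbT.
case: (posnP c) => //= c0.
rewrite /ctype mulnC lognM // (pfactorK 1) // add1n ltnS expnS divnMl //= !xpair_eqE.
by case: (odd _); case: b.
Qed.

(** Coordinates are independent, so the vectors with a given tuple of types form a product set. *)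
Lemma card_ctypes n K (F : pred {ffun 'I_n.+1 -> bool * C}) :
  let N := K.*2 + e in
  #|[pred c : {ffun 'I_n.+1 -> 'I_(p ^ N)} |
     [forall i, small_val p K (c i)] && F [ffun i => ctype (c i)]]|
  = \sum_(f | F f) \prod_i ctype_count K.*2 (f i).
Proof.
move=> N; rewrite -sum1_card.
rewrite (partition_big (fun c : {ffun 'I_n.+1 -> 'I_(p ^ N)} => [ffun i => ctype (c i)]) F) /=;
  last by move=> c /andP[].
apply: eq_bigr => f Ff; rewrite sum1_card.
transitivity #|family (fun i => [pred x : 'I_(p ^ N) | small_val p K x && (ctype x == f i)])|.
  apply: eq_card => c; rewrite !inE; apply/idP/forallP => [/andP[/andP[/forallP gc _] /eqP <-] i|cP].
    by rewrite inE gc /= ffunE.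
  have cf : [ffun i => ctype (c i)] = f.
    by apply/ffunP => i; have := cP i; rewrite inE ffunE => /andP[_ /eqP].
  rewrite unfold_in inE cf eqxx Ff !andbT; apply/forallP => i.
  by have := cP i; rewrite inE => /andP[].
rewrite card_family foldrE big_map big_enum; apply: eq_bigr => i _.
rewrite (card_ord_sum (p ^ N) (fun x => small_val p K x && (ctype x == f i))).
by apply: eq_bigr => x _; rewrite /small_val andbA.
Qed.

End Counting.

Section Density.
Variables (R : realType) (p : nat) (C : finType) (kappa : nat -> C) (h : nat).
Hypothesis p_prime : prime p.
Let p_gt0 : (0 < p)%N := prime_gt0 p_prime.
Let e := lift_exp p.
Hypothesis kappa_mod : forall u, kappa (u %% p ^ e)%N = kappa u.
Hypothesis kappa_card : forall k,
  (\sum_(0 <= r < p ^ e) (~~ (p %| r) && (kappa r == k)))%N = h.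
Hypothesis card_C : (#|C| * h * p = p ^ e * p.-1)%N.
Local Open Scope ring_scope.
Let q : R := p%:R.
Let q_gt0 : 0 < q. Proof. by rewrite ltr0n. Qed.
Let q_gt1 : 1 < q. Proof. by rewrite ltr1n prime_gt1. Qed.
Let q_neq0 : q != 0. Proof. by rewrite gt_eqF. Qed.
(** Total weight of the types: 1 for each class of even valuation, [q^-1] for each of odd
    valuation. *)
Let W : R := #|C|%:R * (1 + q^-1).

Lemma card_C_real : #|C|%:R * h%:R * q = q ^+ e * (q - 1).
Proof.
have := congr1 (fun n => n%:R : R) card_C; rewrite !natrM natrX => ->.
by rewrite -subn1 natrB.
Qed.

Lemma W_gt0 : 0 < W.
Proof.
rewrite mulr_gt0 ?addr_gt0 ?invr_gt0 // ltr0n.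
have : (0 < #|C| * h * p)%N.
  by rewrite card_C muln_gt0 expn_gt0 p_gt0 /= -subn1 subn_gt0 prime_gt1.
by rewrite !muln_gt0 => /andP[/andP[]].
Qed.

(** Two steps of the recursion restore the parity [b], whence an induction by twos;
    [1 - q ^- 2 ^+ K] is the measure of the valuations below [K.*2]. *)
Lemma ctype_density K b k :
  (ctype_count p kappa K.*2 (b, k))%:R / q ^+ (K.*2 + e) = (1 - q ^- 2 ^+ K) / W * q^-1 ^+ b.
Proof.
have cS j b' : ctype_count p kappa j.+1 (b', k) = _ := ctype_countS p_prime kappa_mod kappa_card j b' k.
have W0 : W != 0 by rewrite gt_eqF ?W_gt0.
have hE : h%:R = q ^+ e * (1 - q ^- 2) / W.
  apply: (canRL (mulfK W0)); rewrite /W.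
  transitivity ((#|C|%:R * h%:R * q) * (1 + q^-1) / q); first by field.
  by rewrite card_C_real; field.
elim: K => [|K IH]; first by rewrite ctype_count0 expr0 subrr !mul0r.
have {}IH : (ctype_count p kappa K.*2 (b, k))%:R =
    (1 - q ^- 2 ^+ K) / W * q^-1 ^+ b * (q ^+ K.*2 * q ^+ e).
  by rewrite -IH exprD mulfVK // mulf_neq0 // expf_neq0.
have X0 : q ^+ K.*2 != 0 by rewrite expf_neq0.
have E0 : q ^+ e != 0 by rewrite expf_neq0.
rewrite doubleS !cS negbK exprD [in RHS]exprS.
case: b IH => IH; rewrite ?mul0n ?mul1n ?add0n ?addn0 natrD natrM IH hE natrX -/q !exprS ?expr1 ?expr0.
all: move: (q ^- 2 ^+ K) (q ^+ K.*2) (q ^+ e) X0 E0 => Y X E X0 E0; field.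
all: by rewrite ?W0 ?q_neq0 ?X0 ?E0 ?expf_neq0.
Qed.

Lemma sum_ctype_weight n :
  \sum_(f : {ffun 'I_n.+1 -> bool * C}) \prod_i q^-1 ^+ (f i).1 = W ^+ n.+1.
Proof.
rewrite -(bigA_distr_bigA (fun (_ : 'I_n.+1) (t : bool * C) => q^-1 ^+ t.1)) prodr_const card_ord.
congr (_ ^+ _); rewrite -(pair_bigA _ (fun (b : bool) (k : C) => q^-1 ^+ b)) /= big_bool /=.
by rewrite !sumr_const expr0 expr1 /W mulrDr mulr1 mulr_natl addrC.
Qed.

Lemma squeeze_ereal (x : \bar R) (u v : nat -> R) (l : R) :
  (forall K, ((u K)%:E <= x <= (v K)%:E)%E) ->
  (u @ \oo --> l)%classic -> (v @ \oo --> l)%classic -> x = l%:E.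
Proof.
move=> uv ul vl; case: x uv => [r| |] uv; last 2 first.
- by have := uv 0; rewrite leye_eq andbF.
- by have := uv 0; rewrite leeNy_eq.
congr EFin; have rl : (((fun=> r) : nat -> R) @ \oo --> l)%classic.
  apply: squeeze_cvgr ul vl; apply: nearW => K; exact: uv.
exact: (cvg_unique _ (cvg_cst r) rl).
Qed.

(** Isotropic types bound the measure from below; the complement of the anisotropic ones, which
    includes all large valuations, bounds it from above. Both weights add up to [W ^+ n.+1], so the
    two bounds have the same limit. *)
Lemma rho_eq n (iso : pred {ffun 'I_n.+1 -> bool * C}) :
  (forall t : 'I_n.+1 -> bool * nat, (forall i, ~~ (p %| (t i).2)%N) ->
     iso_fun p t <-> iso [ffun i => ((t i).1, kappa (t i).2)]) ->
  rho R p n 2 = (\sum_(f | iso f) \prod_i q^-1 ^+ (f i).1 / W ^+ n.+1)%:E.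
Proof.
move=> isoP.
pose D (F : pred {ffun 'I_n.+1 -> bool * C}) := \sum_(f | F f) \prod_i q^-1 ^+ (f i).1.
pose cnt K F := [pred c : {ffun 'I_n.+1 -> 'I_(p ^ (K.*2 + e))} |
     [forall i, small_val p K (c i)] && F [ffun i => ctype p kappa (c i)]].
have cntE K F : #|cnt K F|%:R / q ^+ ((K.*2 + e) * n.+1) = ((1 - q ^- 2 ^+ K) / W) ^+ n.+1 * D F.
  rewrite card_ctypes natr_sum mulr_suml mulr_sumr; apply: eq_bigr => f _.
  have constE (x : R) : x ^+ n.+1 = \prod_(i < n.+1) x by rewrite prodr_const card_ord.
  rewrite natr_prod exprM !constE -prodfV -!big_split /=.
  by apply: eq_bigr => i _; case: (f i) => b k; rewrite ctype_density.
have typ K (a : zvec p n) : (forall i, small_val p K (zval (a i) (K.*2 + e))) ->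
    iso_fun p (fun i => vtype p (zval (a i) (K.*2 + e))) <->
    iso [ffun i => ctype p kappa (zred (K.*2 + e) a i)].
  move=> ga; rewrite isoP; last by move=> i; have /andP[a0 _] := ga i; apply: unit_partN.
  by rewrite [X in iso X <-> _](_ : _ = [ffun i => ctype p kappa (zred (K.*2 + e) a i)]) //;
    apply/ffunP => i; rewrite !ffunE.
have W0 : W != 0 by rewrite gt_eqF ?W_gt0.
have Dsplit : D iso + D (predC iso) = W ^+ n.+1.
  by rewrite -sum_ctype_weight [RHS](bigID iso).
have lamE (d : R) : ((fun K => ((1 - q ^- 2 ^+ K) / W) ^+ n.+1 * d) @ \oo --> (d / W ^+ n.+1 : R))%classic.
  have -> : d / W ^+ n.+1 = ((1 - 0) / W) ^+ n.+1 * d by rewrite subr0 mul1r exprVn mulrC.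
  apply: cvgMr_tmp; apply: (@cvg_comp _ _ _ (fun K => (1 - q ^- 2 ^+ K) / W) (fun x : R => x ^+ n.+1)); last first.
    exact: exprn_continuous.
  apply: cvgMr_tmp; apply: cvgB; first exact: cvg_cst.
  apply: cvg_expr; rewrite ger0_norm ?invr_ge0 ?exprn_ge0 ?(ltW q_gt0) //.
  by rewrite invf_lt1 ?exprn_gt0 // exprn_egt1.
rewrite (_ : \sum_(f | iso f) _ = D iso / W ^+ n.+1); last by rewrite mulr_suml.
apply: (@squeeze_ereal _ (fun K => ((1 - q ^- 2 ^+ K) / W) ^+ n.+1 * D iso)
          (fun K => 1 - ((1 - q ^- 2 ^+ K) / W) ^+ n.+1 * D (predC iso))).
- move=> K; apply/andP; split.
    rewrite -cntE; apply: haar_ge; first exact: prime_gt1.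
    move=> a /andP[/forallP ga ia]; apply: (@iso_fun_point p n K p_prime).
      by move=> i; have := ga i; rewrite ffunE.
    by apply/typ => // i; have := ga i; rewrite ffunE.
  rewrite -cntE.
  have -> : 1 - #|cnt K (predC iso)|%:R / q ^+ ((K.*2 + e) * n.+1) =
      #|predC (cnt K (predC iso))|%:R / q ^+ ((K.*2 + e) * n.+1).
    have := cardC (cnt K (predC iso)); rewrite card_ffun !card_ord -expnM.
    move=> /(congr1 (fun n => n%:R : R)); rewrite natrD natrX -/q => E.
    apply/eqP; rewrite subr_eq addrC -mulrDl E divff // expf_neq0 //.
  apply: haar_le; first exact: prime_gt1.
  move=> a Sa; apply/negP => /andP[/forallP ga /negP]; apply.
  have ga' i : small_val p K (zval (a i) (K.*2 + e)) by have := ga i; rewrite ffunE.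
  by apply/typ => //; apply: point_iso_fun.
- exact: lamE.
have -> : D iso / W ^+ n.+1 = 1 - D (predC iso) / W ^+ n.+1.
  by apply/eqP; rewrite eq_sym subr_eq -mulrDl Dsplit divff // expf_neq0.
by apply: cvgB; [exact: cvg_cst|exact: lamE].
Qed.

End Density.

(** * Isotropy of lists of types *)

Section Seq.
Variable p : nat.
Let e := lift_exp p.

(** Isotropy read along a list, one variable at a time: [h] records whether a unit was used at
    parity [s], [v] is the partial sum. *)
Fixpoint reps (s : bool) (l : seq (bool * nat)) (h : bool) (v : nat) : Prop :=
  if l is t :: l' then
    exists x, reps s l' (h || (t.1 == s) && ~~ (p %| x)) (v + sterm p s t x)
  else h /\ p ^ e %| v.

Lemma reps_map (I : eqType) (t : I -> bool * nat) s (r : seq I) h v : uniq r ->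
  reps s (map t r) h v <-> exists x : I -> nat,
    h || has (fun i => ((t i).1 == s) && ~~ (p %| x i)) r /\
    p ^ e %| v + \sum_(i <- r) sterm p s (t i) (x i).
Proof.
elim: r h v => [|i r IH] h v /=.
  move=> _; split=> [[-> ev]|[x]]; first by exists (fun=> 0); rewrite big_nil addn0.
  by rewrite big_nil addn0 orbF => -[].
move=> /andP[ir ur]; split=> [[y /(IH _ _ ur) [x [hx Hx]]]|[x [hx Hx]]].
  exists (fun j => if j == i then y else x j); rewrite eqxx big_cons eqxx.
  have E j : j \in r -> (j == i) = false by move=> jr; apply: contraNF ir => /eqP <-.
  split; first by rewrite (@eq_in_has _ _ (fun j => ((t j).1 == s) && ~~ (p %| x j))) ?orbA // => j /E ->.
  rewrite addnA (eq_big_seq (fun j => sterm p s (t j) (x j))) // => j /E -> //.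
exists (x i); apply/(IH _ _ ur); exists x.
by rewrite -orbA -addnA -(big_cons _ _ _ _ xpredT (fun i => sterm p s (t i) (x i))).
Qed.

Lemma iso_fun_reps n (t : 'I_n.+1 -> bool * nat) :
  iso_fun p t <-> exists s, reps s [seq t i | i <- enum 'I_n.+1] false 0.
Proof.
split=> [[s [x [[i ti xi] Hx]]]|[s /(reps_map _ _ _ _ (enum_uniq _)) [x [/= /hasP[i _ /andP[/eqP ti xi]] Hx]]]].
  exists s; apply/(reps_map _ _ _ _ (enum_uniq _)); exists x; split.
    by apply/orP; right; apply/hasP; exists i; rewrite ?mem_enum // ti eqxx.
  by rewrite add0n big_enum.
by exists s, x; split; [exists i | rewrite add0n big_enum in Hx].
Qed.

End Seq.

Lemma iso_fun_mod p n (t t' : 'I_n.+1 -> bool * nat) :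
  (forall i, (t i).1 = (t' i).1) -> (forall i, (t i).2 = (t' i).2 %[mod p ^ lift_exp p]) ->
  iso_fun p t -> iso_fun p t'.
Proof.
move=> E1 E2 [s [x [[i ti xi] Hx]]]; exists s, x; split; first by exists i; rewrite -?E1.
rewrite -(eq_modn_dvd (m1 := \sum_j sterm p s (t j) (x j))) //.
apply: eq_modn_sum => j _; rewrite (surjective_pairing (t j)) (surjective_pairing (t' j)) E1.
exact: sterm_mod.
Qed.

(** * Words of types and their generating polynomials *)

Section Words.
Variable (T : finType) (L : seq T).
Hypothesis (L_uniq : uniq L) (L_full : forall t, t \in L).

(** An explicit list, so that isotropic tuples can be counted by [vm_compute]. *)
Fixpoint words n : seq (seq T) :=
  if n is n'.+1 then [seq t :: l | t <- L, l <- words n'] else [:: [::]].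

Lemma words_uniq n : uniq (words n).
Proof.
elim: n => //= n IH; apply: allpairs_uniq => //.
by move=> [t l] [t' l'] _ _ /= [-> ->].
Qed.

Lemma mem_words n l : (l \in words n) = (size l == n).
Proof.
elim: n l => [|n IH] l /=; first by rewrite inE size_eq0.
apply/allpairsP/idP => [[[t l'] /= [_ + ->]]|]; first by rewrite IH.
by case: l => // t l /=; rewrite eqSS => sl; exists (t, l); rewrite IH.
Qed.

Lemma sum_words (R : nmodType) n (F : seq T -> R) :
  (\sum_(f : {ffun 'I_n -> T}) F [seq f i | i <- enum 'I_n] = \sum_(l <- words n) F l)%R.
Proof.
rewrite -[LHS](big_map (fun f : {ffun 'I_n -> T} => [seq f i | i <- enum 'I_n]) xpredT F).
apply: perm_big; apply: uniq_perm; last 1 first.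
- move=> l; rewrite mem_words; apply/mapP/eqP => [[f _ ->]|sl]; first by rewrite size_map size_enum_ord.
  case: n sl => [|n] sl.
    exists (ffun0 (card_ord 0)); rewrite ?mem_index_enum //.
    by rewrite (size0nil sl) enum_ord0.
  have [t0 _] : exists t : T, True by case: l sl => // t; exists t.
  exists [ffun i : 'I_n.+1 => nth t0 l i]; first exact: mem_index_enum.
  rewrite (eq_map (g := (nth t0 l) \o val)); last by move=> i; rewrite ffunE.
  by rewrite map_comp val_enum_ord -sl; apply/esym/mkseq_nth.
- rewrite map_inj_uniq ?index_enum_uniq // => f g /eq_in_map E.
  by apply/ffunP => i; apply: E; rewrite mem_enum.
- exact: words_uniq.
Qed.

(** Grouping the words by their number [j] of letters satisfying [par] turns the weighted sum into a
    polynomial in [x]. *)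
Lemma sum_weight (R : comNzRingType) n (iso : pred (seq T)) (par : pred T) (x : R) (cs : seq nat) :
  [seq count (fun l => (count par l == j) && iso l) (words n) | j <- iota 0 n.+1] = cs ->
  (\sum_(f : {ffun 'I_n -> T} | iso [seq f i | i <- enum 'I_n]) \prod_i x ^+ par (f i) =
   \sum_(j < n.+1) (nth 0%N cs j)%:R * x ^+ j)%R.
Proof.
move=> csE; transitivity
  (\sum_(j < n.+1) (count (fun l => (count par l == j) && iso l) (words n))%:R * x ^+ j)%R; last first.
  by apply: eq_bigr => j _; rewrite -csE (nth_map 0) ?size_iota // nth_iota.
transitivity (\sum_(l <- words n) (if iso l then x ^+ count par l else 0))%R.
  rewrite -(sum_words _ (fun l => if iso l then x ^+ count par l else 0)%R) big_mkcond.
  apply: eq_bigr => f _; case: ifP => // _.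
  rewrite (_ : count _ _ = \sum_i par (f i)) ?expr_sum //.
  by rewrite -sum1_count big_map big_mkcond big_enum; apply: eq_bigr => i _; case: (par _).
under [RHS]eq_bigr => j _ do rewrite -sum1_count natr_sum mulr_suml big_mkcond /=.
rewrite exchange_big /= !big_seq; apply: eq_bigr => l; rewrite mem_words => /eqP sl.
have jP : count par l < n.+1 by rewrite ltnS -sl count_size.
rewrite (bigD1 (Ordinal jP)) //= eqxx /= mul1r big1 ?addr0 // => j; rewrite -val_eqE /= => jN.
by rewrite eq_sym (negbTE jN).
Qed.

End Words.

(** * The prime 2 *)

(** Bits 1 and 2 of [u]; for odd [u] they are its class mod 8. *)
Definition class8 (u : nat) : bool * bool := (odd (u %/ 2), odd (u %/ 4)).
Definition repr8 (k : bool * bool) : nat := 1 + k.1 * 2 + k.2 * 4.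

Lemma class8_mod u : class8 (u %% 2 ^ lift_exp 2) = class8 u.
Proof. by rewrite /class8 (_ : 2 ^ lift_exp 2 = 8) //; congr pair; lia. Qed.

Lemma repr8P u : odd u -> u = repr8 (class8 u) %[mod 2 ^ lift_exp 2].
Proof. by rewrite /repr8 /class8 (_ : 2 ^ lift_exp 2 = 8) //= => uodd; lia. Qed.

Lemma class8_card k : \sum_(0 <= r < 2 ^ lift_exp 2) (~~ (2 %| r) && (class8 r == k)) = 1.
Proof. by rewrite unlock; case: k => -[] []. Qed.

(* Modulo [8] the only squares are [1], [0] and [4].  The nested conditionals
   stand for a disjunction and make [vm_compute] stop at the first success. *)
Fixpoint reps8 (s : bool) (l : seq (bool * nat)) (h : bool) (v : nat) : bool :=
  if l is (b, u) :: l' then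
    let c := if b == s then u else u.*2 in
    if reps8 s l' (h || (b == s)) ((v + c) %% 8) then true
    else if reps8 s l' h v then true else reps8 s l' h ((v + 4 * c) %% 8)
  else h && (8 %| v).

Lemma reps8_cons s b u l h v (c := if b == s then u else u.*2) :
  reps8 s ((b, u) :: l) h v = [|| reps8 s l (h || (b == s)) ((v + c) %% 8), reps8 s l h v
                               | reps8 s l h ((v + 4 * c) %% 8)].
Proof. by rewrite /=; do 2!case: ifP => //. Qed.

Lemma reps8_mod s l h v v' : v = v' %[mod 8] -> reps8 s l h v = reps8 s l h v'.
Proof.
elim: l h v v' => [|[b u] l IH] h v v' E; first by rewrite /= (eq_modn_dvd E).
by rewrite !reps8_cons (IH h v v') // -(modnDml v) E modnDml -(modnDml v (4 * _)) E modnDml.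
Qed.

Lemma reps8P s l h v : reps8 s l h v <-> reps 2 s l h v.
Proof.
elim: l h v => [|[b u] l IH] h v; first by split=> [/andP[]|[/= -> ?]].
rewrite reps8_cons [X in _ <-> X]/=; set c := if b == s then u else u.*2.
have cE x : sterm 2 s (b, u) x = c * x ^ 2.
  by rewrite /sterm /c /=; case: (b == s); rewrite ?mul1n ?mul2n.
split.
  case/or3P => H; [exists 1|exists 0|exists 2]; apply/IH; rewrite cE /=.
  - by rewrite andbT muln1 -(reps8_mod _ _ _ (modn_mod _ 8)).
  - by rewrite muln0 addn0 andbF orbF.
  - by rewrite andbF orbF mulnC -(reps8_mod _ _ _ (modn_mod _ 8)).
move=> [x /IH]; rewrite cE dvdn2 negbK => H; apply/or3P.
case ox: (odd x) H; rewrite ?andbT ?andbF ?orbF => H.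
  constructor 1; rewrite (@reps8_mod _ _ _ _ (v + c * x ^ 2)) // modn_mod.
  apply: eq_modnD => //; rewrite -[c in LHS]muln1; apply: eq_modnM => //.
  have := odd_double_half x; rewrite ox => <-; rewrite -mulnn.
  (* [(2y + 1)^2 = 4y(y + 1) + 1] with [y(y + 1)] even. *)
  have : odd (x./2 * (x./2).+1) = false by rewrite oddM /= andbN.
  by move: x./2 => y; lia.
have : (x ^ 2 = 0 %[mod 8]) \/ (x ^ 2 = 4 %[mod 8]).
  have := odd_double_half x; rewrite ox => <-; rewrite -mulnn add0n.
  have := odd_double_half x./2; move: x./2 => y.
  by case: (odd y) => <-; [right|left]; move: y./2 => z; lia.
case=> E; [constructor 2|constructor 3].
  rewrite (@reps8_mod _ _ _ _ (v + c * x ^ 2)) //.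
  transitivity ((v + c * 0) %% 8); first by rewrite muln0 addn0.
  by apply: eq_modnD => //; apply: eq_modnM.
rewrite (@reps8_mod _ _ _ _ (v + c * x ^ 2)) // modn_mod mulnC.
by apply: eq_modnD => //; apply: eq_modnM.
Qed.

(** The additional variables are set to 0. *)
Lemma reps8_cat s l l' h v : reps8 s l h v -> reps8 s (l ++ l') h v.
Proof.
elim: l h v => [|[b u] l IH] h v; last first.
  by rewrite cat_cons !reps8_cons => /or3P[] /IH ->; rewrite ?orbT.
by elim: l' => // -[b u] l' IH /IH {}IH; rewrite cat0s reps8_cons; rewrite cat0s in IH; rewrite IH orbT.
Qed.

Definition iso2 (l : seq (bool * (bool * bool))) : bool :=
  let l' := [seq (t.1, repr8 t.2) | t <- l] in 
  if reps8 false l' false 0 then true else reps8 true l' false 0.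

Lemma iso2E l (l' := [seq (t.1, repr8 t.2) | t <- l]) :
  iso2 l = reps8 false l' false 0 || reps8 true l' false 0.
Proof. by []. Qed.

Lemma iso2P n (t : 'I_n.+1 -> bool * nat) : (forall i, ~~ (2 %| (t i).2)) ->
  iso_fun 2 t <->
  iso2 [seq [ffun i => ((t i).1, class8 (t i).2)] i | i <- enum 'I_n.+1].
Proof.
move=> tu.
have E2 i : (t i).2 = repr8 (class8 (t i).2) %[mod 2 ^ lift_exp 2].
  by apply: repr8P; have := tu i; rewrite dvdn2 negbK.
have -> : iso_fun 2 t <-> iso_fun 2 (fun i => ((t i).1, repr8 (class8 (t i).2))).
  by split; apply: iso_fun_mod.
rewrite iso_fun_reps iso2E -map_comp.
rewrite (eq_map (g := fun i => ((t i).1, repr8 (class8 (t i).2)))); last by move=> i /=; rewrite ffunE.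
split=> [[s /reps8P H]|/orP[] /reps8P H]; last 2 first.
- by exists false.
- by exists true.
by case: s H => ->; rewrite ?orbT.
Qed.

Definition types2 : seq (bool * (bool * bool)) :=
  [seq (b, k) | b <- [:: false; true],
                k <- [:: (false, false); (false, true); (true, false); (true, true)]].

Lemma types2_uniq : uniq types2. Proof. by []. Qed.
Lemma types2_full t : t \in types2. Proof. by case: t => -[] [[] []]. Qed.

(** The conditional unfolds [&&]; under [vm_compute] it tests isotropy only for words with [j] odd
    valuations. *)
Lemma iso2_count3 :
  [seq count (fun l => if count fst l == j then iso2 l else false) (words types2 3) | j <- iota 0 4]
  = [:: 48; 96; 96; 48].
Proof. by vm_compute. Qed.

Lemma iso2_count4 :
  [seq count (fun l => if count fst l == j then iso2 l else false) (words types2 4) | j <- iota 0 5]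
  = [:: 240; 1024; 1344; 1024; 240].
Proof. by vm_compute. Qed.

(** Only the 224 anisotropic words of length four are extended by a fifth letter. *)
Lemma iso2_words5 :
  all (fun l => if iso2 l then true else all (fun t => iso2 (t :: l)) types2) (words types2 4).
Proof. by vm_compute. Qed.

(** The first five variables already give a zero; the others are taken to be 0. *)
Lemma iso2_size5 l : 5 <= size l -> iso2 l.
Proof.
case: l => [|t l] // sl; rewrite -(cat_take_drop 4 l).
have := allP iso2_words5 (take 4 l).
have -> : take 4 l \in words types2 4 by rewrite mem_words ?size_takel // => ?; exact: types2_full.
move=> /(_ isT); case: ifP => [H _|_ /allP /(_ t (types2_full t)) H]; move: H; rewrite !iso2E.
  by rewrite map_cons map_cat => /orP[] /(reps8_cat [seq (t.1, repr8 t.2) | t <- drop 4 l]) H;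
    rewrite !reps8_cons H ?orbT.
by rewrite -cat_cons map_cat => /orP[] /(reps8_cat [seq (t.1, repr8 t.2) | t <- drop 4 l]) ->;
  rewrite ?orbT.
Qed.

(** * Odd primes *)

Section FiniteFieldSquares.
Variable F : finFieldType.
Hypothesis two_neq0 : (2 != 0 :> F)%R.
Local Open Scope ring_scope.

Definition is_sq (z : F) : bool := [exists y, y ^+ 2 == z].

Lemma is_sqP z : reflect (exists y, z = y ^+ 2) (is_sq z).
Proof. by apply: (iffP existsP) => -[y]; [move/eqP <-; exists y | move=> ->; exists y]. Qed.

(** Squaring is two-to-one on nonzero elements, as [y] and [- y] differ. *)
Lemma card_sq_neq0 : (#|[set z : F | (z != 0%R) && is_sq z]|.*2 = #|F|.-1)%N.
Proof.
rewrite -(cardC1 (0 : F)) -[RHS]sum1_card -muln2 -sum_nat_const.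
rewrite [RHS](partition_big (fun y => y ^+ 2) (mem [set z : F | (z != 0) && is_sq z])); last first.
  by move=> y; rewrite !inE => y0; rewrite expf_neq0 //; apply/is_sqP; exists y.
apply: eq_bigr => z; rewrite inE => /andP[z0 /is_sqP [y zE]].
have y0 : y != 0 by apply: contraNneq z0 => yE; rewrite zE yE expr0n.
rewrite sum1_card (@eq_card _ _ (pred2 y (- y))).
  rewrite card2 -subr_eq0 opprK -mulr2n -mulr_natl mulf_eq0 negb_or.
  by rewrite two_neq0 y0.
move=> x; rewrite [LHS]unfold_in !inE zE eqf_sqr; case: eqVneq => //= x0.
by rewrite x0 eq_sym (negbTE y0) eq_sym oppr_eq0 (negbTE y0).
Qed.

Lemma card_nsq : (#|[set z : F | ~~ is_sq z]|.*2 = #|F|.-1)%N.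
Proof.
have F0 : (0 < #|F|)%N by apply/card_gt0P; exists 0.
have sq0 : is_sq 0 by apply/is_sqP; exists 0; rewrite expr0n.
have sqD : [set z : F | is_sq z] :\ 0 = [set z : F | (z != 0) && is_sq z].
  by apply/setP => z; rewrite !inE.
have sqC : ~: [set z : F | is_sq z] = [set z : F | ~~ is_sq z] by apply/setP => z; rewrite !inE.
have := cardsC [set z : F | is_sq z]; rewrite (cardsD1 0) inE sq0 sqD sqC.
have aux (A B f : nat) : (0 < f -> A.*2 = f.-1 -> 1 + A + B = f -> B.*2 = f.-1)%N by lia.
exact: aux F0 card_sq_neq0.
Qed.

Lemma is_sqM a b : a != 0 -> b != 0 -> is_sq (a * b) = (is_sq a == is_sq b).
Proof.
have sqM x y : x != 0 -> is_sq x -> is_sq (x * y) = is_sq y.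
  move=> x0 /is_sqP [u xE]; have u0 : u != 0 by apply: contraNneq x0 => uE; rewrite xE uE expr0n.
  apply/is_sqP/is_sqP => -[v vE]; last by exists (u * v); rewrite exprMn -xE vE.
  by exists (v / u); rewrite expr_div_n -vE -xE mulrC mulKf.
move=> a0 b0; case sa : (is_sq a); first by rewrite sqM // eqb_id.
case sb : (is_sq b); first by rewrite mulrC sqM // sa.
(* Multiplication by the nonsquare [a] sends nonzero squares injectively to nonsquares, onto by
   cardinality. So [b = a * y ^+ 2] and [a * b] is a square. *)
have E : [set a * z | z in [set z : F | (z != 0) && is_sq z]] = [set z : F | ~~ is_sq z].
  apply/eqP; rewrite eqEcard; apply/andP; split.
    apply/fintype.subsetP => _ /imsetP [z + ->]; rewrite !inE => /andP[z0 sz].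
    by rewrite mulrC sqM // sa.
  rewrite card_imset; last exact: mulfI.
  by rewrite -leq_double card_nsq card_sq_neq0.
have : b \in [set z : F | ~~ is_sq z] by rewrite inE sb.
rewrite -E => /imsetP [z]; rewrite inE => /andP[z0 /is_sqP [y zE]] ->.
by apply/is_sqP; exists (a * y); rewrite exprMn -zE mulrA.
Qed.

(** Pigeonhole: the values [a * x ^+ 2] and [- c - b * y ^+ 2] each fill more than half of the
    field. *)
Lemma ternary_solvable a b c : a != 0 -> b != 0 ->
  exists x y : F, a * x ^+ 2 + b * y ^+ 2 + c = 0.
Proof.
move=> a0 b0; pose Q := [set z : F | is_sq z].
have F0 : (0 < #|F|)%N by apply/card_gt0P; exists 0.
have cQ : (#|F| < #|Q|.*2)%N.
  have sqC : ~: Q = [set z : F | ~~ is_sq z] by apply/setP => z; rewrite !inE.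
  have := cardsC Q; rewrite sqC.
  have aux (A B f : nat) : (0 < f -> B.*2 = f.-1 -> A + B = f -> f < A.*2)%N by lia.
  exact: aux F0 card_nsq.
have : ~~ [disjoint [set a * z | z in Q] & [set - c - b * z | z in Q]].
  apply: contraTN cQ; rewrite -finset.setI_eq0 -leqNgt => /eqP dis.
  have := max_card (mem ([set a * z | z in Q] :|: [set - c - b * z | z in Q])).
  rewrite cardsU dis cards0 subn0 !card_imset ?addnn //; last exact: mulfI.
  by move=> x y /addrI /oppr_inj; apply: mulfI.
rewrite -finset.setI_eq0 => /set0Pn [_ /setIP [/imsetP [z zQ ->] /imsetP [w wQ E]]].
move: zQ wQ E; rewrite !inE => /is_sqP [x ->] /is_sqP [y ->] E.
by exists x, y; rewrite E subrK addNr.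
Qed.

End FiniteFieldSquares.

(** * Residue forms at an odd prime *)

Definition qres (p u : nat) : bool := [exists y : 'I_p, y ^ 2 == u %[mod p]].

(** Isotropy of a diagonal form over [F_p] with square classes [m], where [eps] tells whether [-1]
    is a square: never in fewer than two variables, iff minus the product of the coefficients is a
    square in two, always in three or more. *)
Definition form_iso (eps : bool) (m : seq bool) : bool :=
  if m is a :: b :: m' then (if m' is [::] then eps == (a == b) else true) else false.

(** Springer's criterion: one of the two residue forms is isotropic. *)
Definition isop (eps : bool) (l : seq (bool * bool)) : bool :=
  has (fun s => form_iso eps [seq t.2 | t <- l & t.1 == s]) [:: false; true].

Section OddPrime.
Variable p : nat.
Hypotheses (p_prime : prime p) (p_neq2 : p != 2).
Let p_gt0 : 0 < p := prime_gt0 p_prime.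
Let p_gt2 : 2 < p. Proof. by rewrite ltn_neqAle eq_sym p_neq2 prime_gt1. Qed.
Let p_odd : odd p. Proof. by case: (even_prime p_prime) p_neq2 => [->|]. Qed.

Lemma lift_exp_odd : lift_exp p = 1.
Proof. by rewrite /lift_exp (negbTE p_neq2). Qed.

Lemma Fp_two_neq0 : (2 != 0 :> 'F_p)%R.
Proof. by rewrite -(dvdn_pcharf (pchar_Fp p_prime)) gtnNdvd. Qed.

Lemma Fp_eq_nat a b : (a == b %[mod p]) = (a%:R == b%:R :> 'F_p)%R.
Proof. by rewrite -val_eqE /= !val_Fp_nat. Qed.

Lemma Fp_nat_eq0 a : (p %| a) = (a%:R == 0 :> 'F_p)%R.
Proof. by rewrite -(dvdn_pcharf (pchar_Fp p_prime)). Qed.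

Lemma Fp_natP (z : 'F_p) : exists a : nat, z = (a%:R)%R.
Proof. by exists z; rewrite natr_Zp. Qed.

Lemma qresE u : qres p u = is_sq (u%:R : 'F_p)%R.
Proof.
apply/existsP/is_sqP => [[y]|[z zE]]; first by rewrite Fp_eq_nat natrX => /eqP <-; exists (y%:R)%R.
have zp : (z : nat) < p by rewrite -[X in _ < X](Fp_cast p_prime) ltn_ord.
by exists (Ordinal zp); rewrite Fp_eq_nat /= natrX natr_Zp zE.
Qed.

Lemma qres_mod u : qres p (u %% p ^ lift_exp p) = qres p u.
Proof. by rewrite lift_exp_odd expn1 /qres; apply: eq_existsb => y; rewrite modn_mod. Qed.

Lemma qres_card k : \sum_(0 <= r < p ^ lift_exp p) (~~ (p %| r) && (qres p r == k)) = p.-1./2.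
Proof.
rewrite lift_exp_odd expn1.
transitivity (\sum_(z : 'F_p) ((z != 0%R) && (is_sq z == k))).
  rewrite -[X in index_iota 0 X](Fp_cast p_prime) big_mkord; apply: eq_bigr => z _.
  by rewrite Fp_nat_eq0 qresE natr_Zp.
have cF : #|'F_p| = p by rewrite card_Fp.
have sq0 : is_sq (0 : 'F_p)%R by apply/is_sqP; exists 0%R; rewrite expr0n.
rewrite -[X in X.-1]cF; case: k.
  rewrite -card_sq_neq0 ?Fp_two_neq0 // doubleK -sum1_card big_mkcond.
  by rewrite [RHS]big_mkcond; apply: eq_bigr => z _; rewrite inE eqb_id; case: ifP.
rewrite -card_nsq ?Fp_two_neq0 // doubleK -sum1_card.
rewrite [RHS]big_mkcond; apply: eq_bigr => z _; rewrite inE eqbF_neg.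
by case: eqVneq => [->|_]; rewrite ?sq0 //; case: ifP.
Qed.

Lemma card_bool_half : #|{: bool}| * p.-1./2 * p = p ^ lift_exp p * p.-1.
Proof.
rewrite card_bool lift_exp_odd expn1 mulnC; congr (_ * _); rewrite mul2n -[RHS]odd_double_half.
by rewrite -subn1 oddB // p_odd.
Qed.

Lemma reps_mod s l h v v' : v = v' %[mod p ^ lift_exp p] -> reps p s l h v -> reps p s l h v'.
Proof.
elim: l h v v' => [|t l IH] h v v' E /=; first by rewrite (eq_modn_dvd E).
by move=> [x H]; exists x; apply: IH H; apply: eq_modnD.
Qed.

Lemma reps_zeros s l v : p ^ lift_exp p %| v -> reps p s l true v.
Proof. by elim: l v => //= t l IH v Hv; exists 0; apply: IH; rewrite /sterm muln0 addn0. Qed.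

(** For odd [p] the modulus is [p], and terms of the other parity carry a factor [p]. *)
Lemma reps_filter s l h v : reps p s l h v <-> reps p s [seq t <- l | t.1 == s] h v.
Proof.
elim: l h v => // t l IH h v /=; case: eqP => ts /=.
  by split=> -[x /IH H]; exists x; move: H; rewrite ts eqxx.
have E x : v + sterm p s t x = v %[mod p ^ lift_exp p].
  by rewrite /sterm (_ : t.1 != s) ?lift_exp_odd; [rewrite expn1 -mulnA addnC mulnC modnMDl|apply/eqP].
split=> [[x]|/IH H]; first by rewrite orbF => /(reps_mod (E x))/IH.
by exists 0; rewrite orbF; apply: reps_mod H; rewrite E.
Qed.

(** A zero has [y] nonzero, and then [- (u * v) = (u * x / y) ^+ 2]. Conversely, if [z] is a square
    root of [- (u * v)], then [(z, u)] is a zero. *)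
Lemma binary_iso u v : ~~ (p %| u) -> ~~ (p %| v) ->
  (exists x y, ~~ (p %| x) || ~~ (p %| y) /\ p %| u * x ^ 2 + v * y ^ 2) <->
  qres p p.-1 == (qres p u == qres p v).
Proof.
rewrite !Fp_nat_eq0 !qresE => u0 v0.
have -> : (p.-1%:R = -1 :> 'F_p)%R.
  by apply/eqP; rewrite -addr_eq0 -[1%R]/(1%:R)%R -natrD addn1 prednK // -Fp_nat_eq0.
have two0 := Fp_two_neq0.
have N0 : (-1 != 0 :> 'F_p)%R by rewrite oppr_eq0 oner_eq0.
have uv0 : (u%:R * v%:R != 0 :> 'F_p)%R by rewrite mulf_neq0.
rewrite -is_sqM // -is_sqM // mulN1r.
split=> [[x [y [xy]]]|/is_sqP [z zE]].
  rewrite Fp_nat_eq0 natrD (natrM _ u) (natrM _ v) !natrX => /eqP E; rewrite !Fp_nat_eq0 in xy.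
  have y0 : (y%:R != 0 :> 'F_p)%R.
    apply: contraTN xy => /eqP y0; move/eqP: E.
    by rewrite y0 expr0n mulr0 addr0 mulf_eq0 (negbTE u0) expf_eq0 /= => ->; rewrite ?eqxx.
  apply/is_sqP; exists (u%:R * x%:R / y%:R)%R.
  have E' : (v%:R = - (u%:R * x%:R ^+ 2) / y%:R ^+ 2 :> 'F_p)%R.
    apply: (canRL (mulfK _)); first by rewrite expf_neq0.
    by apply/eqP; rewrite -addr_eq0 addrC E.
  by rewrite E'; field.
have [x xE] := Fp_natP z; exists x, u; split; first by rewrite orbC Fp_nat_eq0 u0.
rewrite Fp_nat_eq0 natrD (natrM _ u) (natrM _ v) !natrX -xE -zE; apply/eqP; ring.
Qed.

Lemma reps_form s (l : seq (bool * nat)) : (forall t, t \in l -> ~~ (p %| t.2)) ->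
  reps p s l false 0 <-> form_iso (qres p p.-1) [seq qres p t.2 | t <- l & t.1 == s].
Proof.
move=> lu; rewrite reps_filter.
have : forall t, t \in [seq t <- l | t.1 == s] -> t.1 = s /\ ~~ (p %| t.2).
  by move=> t; rewrite mem_filter => /andP[/eqP ts /lu].
case: [seq t <- l | t.1 == s] => [|[a u] [|[b v] [|[c w] m]]] tu.
- by split=> // -[].
- have [/= -> u0] := tu _ (mem_head _ _); split=> //= -[x []].
  rewrite lift_exp_odd eqxx /= add0n => px; rewrite /sterm /= eqxx mul1n expn1.
  by rewrite !Euclid_dvdM // (negbTE u0) (negbTE px).
- have [/= -> u0] := tu _ (mem_head _ _).
  have [|/= -> v0] := tu (b, v); first by rewrite !inE eqxx orbT.
  rewrite -binary_iso // lift_exp_odd /sterm /= eqxx.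
  by split=> -[x [y]]; rewrite ?mul1n ?add0n ?expn1 => H; exists x, y; rewrite ?mul1n ?add0n ?expn1.
- have [/= -> u0] := tu _ (mem_head _ _).
  have [|/= -> v0] := tu (b, v); first by rewrite !inE eqxx orbT.
  have [|/= -> w0] := tu (c, w); first by rewrite !inE eqxx !orbT.
  split=> // _; rewrite /sterm /= eqxx.
  rewrite !Fp_nat_eq0 in u0 v0.
  have [x [y E]] := ternary_solvable Fp_two_neq0 (w%:R : 'F_p)%R u0 v0.
  have [a' aE] := Fp_natP x; have [b' bE] := Fp_natP y.
  (* The third variable, equal to 1, is the required unit; all later ones are 0. *)
  exists a', b', 1; rewrite dvdn1 (gtn_eqF (prime_gt1 p_prime)) orbT; apply: reps_zeros.
  rewrite lift_exp_odd expn1 !mul1n add0n muln1 Fp_nat_eq0 !natrD (natrM _ u) (natrM _ v) !natrX -aE -bE.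
  by rewrite E.
Qed.

Lemma isopP n (t : 'I_n.+1 -> bool * nat) : (forall i, ~~ (p %| (t i).2)) ->
  iso_fun p t <->
  isop (qres p p.-1) [seq [ffun i => ((t i).1, qres p (t i).2)] i | i <- enum 'I_n.+1].
Proof.
move=> tu; rewrite iso_fun_reps.
rewrite (eq_map (g := (fun t => (t.1, qres p t.2)) \o t)); last by move=> i /=; rewrite ffunE.
rewrite map_comp; set l := map t _.
have lu u : u \in l -> ~~ (p %| u.2) by move=> /mapP [i _ ->].
have fE s : [seq u.2 | u <- [seq (u.1, qres p u.2) | u <- l] & u.1 == s] =
            [seq qres p u.2 | u <- l & u.1 == s].
  by rewrite filter_map -map_comp.
rewrite /isop /= !fE orbF; split=> [[s /reps_form]|/orP[] H]; last 2 first.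
- by exists false; apply/reps_form.
- by exists true; apply/reps_form.
by case: s => /(_ lu) ->; rewrite ?orbT.
Qed.

End OddPrime.

(** Among five entries, three share their parity. *)
Lemma isop_size5 eps l : 5 <= size l -> isop eps l.
Proof.
have fi m : 2 < size m -> form_iso eps m by case: m => [|? [|? []]].
rewrite -(count_predC (fun t : bool * bool => t.1 == false)).
rewrite (@eq_count _ (predC _) (fun t => t.1 == true)); last by move=> [[] ?].
rewrite -!size_filter /isop /= orbF => H; apply/orP.
by have [|] := leqP 3 (size [seq t <- l | t.1 == false]) => H';
  [left|right]; apply: fi; rewrite size_map //; move: H H'; move: (size _) (size _) => a b; lia.
Qed.

Definition typesp : seq (bool * bool) :=
  [:: (false, false); (false, true); (true, false); (true, true)].

Lemma typesp_uniq : uniq typesp. Proof. by []. Qed.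
Lemma typesp_full t : t \in typesp. Proof. by case: t => -[] []. Qed.

(** Of the 8, 24, 24, 8 words, only those split as 2 + 1 by parity can be anisotropic, and half of
    them are. *)
Lemma isop_count3 eps :
  [seq count (fun l => (count fst l == j) && isop eps l) (words typesp 3) | j <- iota 0 4]
  = [:: 8; 12; 12; 8].
Proof. by case: eps; vm_compute. Qed.

(** Only the 96 words split as 2 + 2 can be anisotropic, and a quarter of them are, both pairs
    having to be anisotropic. *)
Lemma isop_count4 eps :
  [seq count (fun l => (count fst l == j) && isop eps l) (words typesp 4) | j <- iota 0 5]
  = [:: 16; 64; 72; 64; 16].
Proof. by case: eps; vm_compute. Qed.

(** * Evaluation of the densities *)

Local Open Scope ring_scope.

Lemma rho2 (R : realType) n : rho R 2 n 2 =
  (\sum_(f : {ffun 'I_n.+1 -> bool * (bool * bool)} | iso2 [seq f i | i <- enum 'I_n.+1])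
     \prod_i (2 : R)^-1 ^+ (f i).1 / 6 ^+ n.+1)%:E.
Proof.
have -> : 6 = #|{: bool * bool}|%:R * (1 + 2^-1) :> R by rewrite card_prod card_bool; field.
apply: (@rho_eq R 2 _ class8 1 isT class8_mod class8_card).
- by rewrite card_prod card_bool.
- exact: iso2P.
Qed.

Lemma rho_odd (R : realType) p n : prime p -> p != 2%N -> rho R p n 2 =
  (\sum_(f : {ffun 'I_n.+1 -> bool * bool} | isop (qres p p.-1) [seq f i | i <- enum 'I_n.+1])
     \prod_i (p%:R : R)^-1 ^+ (f i).1 / (2 * (1 + p%:R^-1)) ^+ n.+1)%:E.
Proof.
move=> p_prime p2; rewrite -[X in (X * _) ^+ _](_ : #|{: bool}|%:R = _); last by rewrite card_bool.
apply: (@rho_eq R p _ (qres p) p.-1./2 p_prime (qres_mod p2) (qres_card p_prime p2)).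
- exact: card_bool_half.
- exact: isopP.
Qed.

(** Every tuple of five or more types is isotropic, so the sum is the whole weight. *)
Lemma rho_one (R : realType) p (C : finType) n (iso : pred (seq (bool * C))) (W : R) : prime p ->
  (forall l, (4 < size l)%N -> iso l) -> W = #|C|%:R * (1 + p%:R^-1) -> W != 0 -> (3 < n)%N ->
  \sum_(f : {ffun 'I_n.+1 -> bool * C} | iso [seq f i | i <- enum 'I_n.+1])
     \prod_i (p%:R : R)^-1 ^+ (f i).1 / W ^+ n.+1 = 1.
Proof.
move=> p_prime isoT WE W0 n4; rewrite -mulr_suml (eq_bigl xpredT); last first.
  by move=> f; rewrite isoT // size_map size_enum_ord.
by rewrite sum_ctype_weight -WE divff // expf_neq0.
Qed.

Theorem theorem1p3 (R : realType) (p : nat) (hp : prime p) :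
  let q : R := p%:R in
  [/\ rho R p 2 2 = (if p == 2%N then 7 / 12
                     else 1 - 3 / 2 * q^-1 * ((1 - q^-1) / (1 - q^-2)) ^+ 2)%:E,
      rho R p 3 2 = (if p == 2%N then 1231 / 1296
                     else 1 - 3 / 2 * q^-2 * ((1 - q^-1) / (1 - q^-2)) ^+ 4)%:E
    & forall n : nat, (4 <= n)%N -> rho R p n 2 = 1%E].
Proof.
move=> q; have q_gt1 : 1 < q by rewrite ltr1n prime_gt1.
have q0 : q != 0 by rewrite gt_eqF // (lt_trans ltr01).
have q1 : q + 1 != 0 by rewrite gt_eqF // addr_gt0 // (lt_trans ltr01).
have qm1 : q - 1 != 0 by rewrite subr_eq0 gt_eqF.
have q2 : q ^+ 2 - 1 != 0 by rewrite subr_sqr_1 mulf_neq0.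
case: eqVneq hp => [->|p2] hp.
  split.
  (* [(48 + 96/2 + 96/4 + 48/8) / 6^3 = 126/216]; for four coefficients, [(240 + 1024/2 + 1344/4 +
     1024/8 + 240/16) / 6^4 = 1231/1296]. *)
  - rewrite rho2 -mulr_suml (sum_weight types2_uniq types2_full _ iso2_count3).
    by rewrite !big_ord_recr big_ord0 /=; congr EFin; field.
  - rewrite rho2 -mulr_suml (sum_weight types2_uniq types2_full _ iso2_count4).
    by rewrite !big_ord_recr big_ord0 /=; congr EFin; field.
  - move=> n n4; rewrite rho2 (@rho_one R 2) //; first exact: iso2_size5.
    by rewrite card_prod card_bool; field.
split.
- rewrite rho_odd // -mulr_suml (sum_weight typesp_uniq typesp_full _ (isop_count3 _)).
  rewrite !big_ord_recr big_ord0 /=; congr EFin; rewrite -/q; field.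
  by rewrite q0 q1 q2.
- rewrite rho_odd // -mulr_suml (sum_weight typesp_uniq typesp_full _ (isop_count4 _)).
  rewrite !big_ord_recr big_ord0 /=; congr EFin; rewrite -/q; field.
  by rewrite q0 q1 q2.
- move=> n n4; rewrite rho_odd // rho_one //; first exact: isop_size5.
  by rewrite card_bool.
Qed.
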